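(* Let $P$ be a poset. The collection $\mathcal{E}_{\operatorname{Rk}}$ of rank-exact sequences defines the structure of an exact category on $\operatorname{rep}P$. Moreover, finite direct sums of objects of the form $\mathbf{k}_{\langle i,j\langle}$, where $i<j\in P\cup\{\infty\}$, are projective with respect to this exact structure. Dually, finite direct sums of objects $\mathbf{k}_{\rangle i,j\rangle}$, with $i<j\in P\cup\{-\infty\}$, are $\mathcal{E}_{\operatorname{Rk}}$-injective.
   Context: Fix a field $\mathbf{k}$. $\operatorname{rep}P$ is the (abelian) category of functors from the poset $P$ to finite-dimensional $\mathbf{k}$-vector spaces. For $M\in\operatorname{rep}P$ and $s\le t$ in $P$, $\operatorname{Rk}M(s,t)=\operatorname{rank}[M(s)\to M(t)]$. A short exact sequence $0\to A\to B\to C\to0$ in $\operatorname{rep}P$ is rank-exact if $\operatorname{Rk}B=\operatorname{Rk}A+\operatorname{Rk}C$ as functions on $\{(s,t)\mid s\le t\}$. For a convex subset $I\subseteq P$, $\mathbf{k}_I$ is the representation equal to $\mathbf{k}$ on $I$, $0$ elsewhere, with identity maps between comparable elements of $I$. With the convention $-\infty<p<\infty$ for all $p\in P$: lower hooks are $\langle i,j\langle=\{\ell\in P\mid i\le\ell\not\ge j\}$ for $i\in P$, $j\in P\cup\{\infty\}$, $i<j$; upper hooks are $\rangle i,j\rangle=\{\ell\in P\mid i\not\ge\ell\le j\}$ for $i\in P\cup\{-\infty\}$, $j\in P$, $i<j$. An exact category (Quillen) is an additive category with a class of kernel-cokernel pairs (first morphisms: admissible monics; second morphisms: admissible epics) such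 that: identities are admissible monics and admissible epics; compositions of admissible monics (epics) are admissible monics (epics); push-outs of admissible monics along arbitrary maps exist and are admissible monics, and pull-backs of admissible epics along arbitrary maps exist and are admissible epics. An object $X$ is projective (resp. injective) with respect to an exact structure $\mathcal{E}$ if $\operatorname{Hom}(X,-)$ (resp. $\operatorname{Hom}(-,X)$) takes the sequences in $\mathcal{E}$ to short exact sequences of abelian groups. *)

(* Defs.v *)
From HB Require Import structures.
From mathcomp Require Import all_boot all_order all_algebra.
From mathcomp Require Import boolp.

Set Implicit Arguments.
Unset Strict Implicit.
Unset Printing Implicit Defensive.

Import Order.TTheory GRing.Theory.
Local Open Scope ring_scope.

Record preadditive := Preadditive {
  obj :> Type;
  mor : obj -> obj -> zmodType;
  idmor : forall X : obj, mor X X;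
  ccomp : forall X Y Z : obj, mor Y Z -> mor X Y -> mor X Z;
  ccomp_idl : forall (X Y : obj) (f : mor X Y), ccomp (idmor Y) f = f;
  ccomp_idr : forall (X Y : obj) (f : mor X Y), ccomp f (idmor X) = f;
  ccompA : forall (X Y Z W : obj) (h : mor Z W) (g : mor Y Z) (f : mor X Y),
    ccomp h (ccomp g f) = ccomp (ccomp h g) f;
  ccompDl : forall (X Y Z : obj) (g1 g2 : mor Y Z) (f : mor X Y),
    ccomp (g1 + g2) f = ccomp g1 f + ccomp g2 f;
  ccompDr : forall (X Y Z : obj) (g : mor Y Z) (f1 f2 : mor X Y),
    ccomp g (f1 + f2) = ccomp g f1 + ccomp g f2
}.

Arguments mor {_} _ _.
Arguments idmor {_} _.
Arguments ccomp {_ _ _ _} _ _.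

Declare Scope preadditive_scope.
Delimit Scope preadditive_scope with PA.
Local Open Scope preadditive_scope.
Notation "g \oc f" := (ccomp g f) (at level 50, left associativity)
  : preadditive_scope.

Section Preadditive.
Variable C : preadditive.

(* [X] is a biproduct of the family [Y]; for [n = 0] this says that [X] is a
   zero object. *)
Definition is_direct_sum (n : nat) (Y : 'I_n -> C) (X : C) : Prop :=
  exists (inj : forall a, mor (Y a) X) (proj : forall a, mor X (Y a)),
    [/\ forall a, proj a \oc inj a = idmor (Y a),
        forall a b, a != b -> proj b \oc inj a = 0
      & \sum_(a < n) (inj a \oc proj a) = idmor X].

Definition additive_category : Prop :=
  forall (n : nat) (Y : 'I_n -> C), exists X : C, is_direct_sum Y X.

Definition is_kernel (X Y Z : C) (f : mor X Y) (g : mor Y Z) : Prop :=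
  g \oc f = 0 /\
  forall (W : C) (h : mor W Y), g \oc h = 0 ->
    exists! u : mor W X, f \oc u = h.

Definition is_cokernel (X Y Z : C) (f : mor X Y) (g : mor Y Z) : Prop :=
  g \oc f = 0 /\
  forall (W : C) (h : mor Y W), h \oc f = 0 ->
    exists! u : mor Z W, u \oc g = h.

Definition kernel_cokernel_pair (X Y Z : C) (f : mor X Y) (g : mor Y Z) :=
  is_kernel f g /\ is_cokernel f g.

(*    X --f--> Y
      |h       |h'
      X' -f'-> Y'    *)
Definition is_pushout (X Y X' Y' : C) (f : mor X Y) (h : mor X X')
    (f' : mor X' Y') (h' : mor Y Y') : Prop :=
  h' \oc f = f' \oc h /\
  forall (W : C) (a : mor Y W) (b : mor X' W), a \oc f = b \oc h ->
    exists! u : mor Y' W, u \oc h' = a /\ u \oc f' = b.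

(*    Y' -g'-> Z'
      |h'      |h
      Y --g--> Z     *)
Definition is_pullback (Y Z Z' Y' : C) (g : mor Y Z) (h : mor Z' Z)
    (g' : mor Y' Z') (h' : mor Y' Y) : Prop :=
  g \oc h' = h \oc g' /\
  forall (W : C) (a : mor W Y) (b : mor W Z'), g \oc a = h \oc b ->
    exists! u : mor W Y', h' \oc u = a /\ g' \oc u = b.

Definition seq_class := forall X Y Z : C, mor X Y -> mor Y Z -> Prop.

Variable E : seq_class.

Definition admissible_monic (X Y : C) (f : mor X Y) : Prop :=
  exists (Z : C) (g : mor Y Z), E f g.

Definition admissible_epic (Y Z : C) (g : mor Y Z) : Prop :=
  exists (X : C) (f : mor X Y), E f g.

Record exact_category : Prop := ExactCategory {
  exact_additive : additive_category;
  exact_kc : forall (X Y Z : C) (f : mor X Y) (g : mor Y Z),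
    E f g -> kernel_cokernel_pair f g;
  exact_id_monic : forall X : C, admissible_monic (idmor X);
  exact_id_epic : forall X : C, admissible_epic (idmor X);
  exact_comp_monic : forall (X Y Z : C) (f : mor X Y) (g : mor Y Z),
    admissible_monic f -> admissible_monic g -> admissible_monic (g \oc f);
  exact_comp_epic : forall (X Y Z : C) (f : mor X Y) (g : mor Y Z),
    admissible_epic f -> admissible_epic g -> admissible_epic (g \oc f);
  exact_pushout_ex : forall (X Y X' : C) (f : mor X Y) (h : mor X X'),
    admissible_monic f ->
    exists (Y' : C) (f' : mor X' Y') (h' : mor Y Y'), is_pushout f h f' h';
  exact_pushout : forall (X Y X' Y' : C) (f : mor X Y) (h : mor X X')
      (f' : mor X' Y') (h' : mor Y Y'),
    admissible_monic f -> is_pushout f h f' h' -> admissible_monic f';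
  exact_pullback_ex : forall (Y Z Z' : C) (g : mor Y Z) (h : mor Z' Z),
    admissible_epic g ->
    exists (Y' : C) (g' : mor Y' Z') (h' : mor Y' Y), is_pullback g h g' h';
  exact_pullback : forall (Y Z Z' Y' : C) (g : mor Y Z) (h : mor Z' Z)
      (g' : mor Y' Z') (h' : mor Y' Y),
    admissible_epic g -> is_pullback g h g' h' -> admissible_epic g'
}.

(* exactness of 0 -> U -> V -> W -> 0 *)
Definition short_exact_ab (U V W : zmodType) (f : U -> V) (g : V -> W) :=
  [/\ injective f,
      forall v : V, g v = 0 <-> exists u : U, f u = v
    & forall w : W, exists v : V, g v = w].

Definition projective_wrt (X : C) : Prop :=
  forall (A B D : C) (f : mor A B) (g : mor B D), E f g ->
    short_exact_ab (fun u : mor X A => f \oc u) (fun v : mor X B => g \oc v).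

Definition injective_wrt (X : C) : Prop :=
  forall (A B D : C) (f : mor A B) (g : mor B D), E f g ->
    short_exact_ab (fun u : mor D X => u \oc g) (fun v : mor B X => v \oc f).

End Preadditive.

Section Rep.
Context {d : Order.disp_t} (P : porderType d) (k : fieldType).

Record rep := Rep {
  rep_obj :> P -> vectType k;
  rep_map : forall s t : P, (s <= t)%O -> 'Hom(rep_obj s, rep_obj t);
  rep_map_id : forall (s : P) (h : (s <= s)%O), rep_map h = \1%VF;
  rep_map_comp : forall (s t u : P) (st : (s <= t)%O) (tu : (t <= u)%O)
      (su : (s <= u)%O),
    rep_map su = (rep_map tu \o rep_map st)%VF
}.

Record nat_trans (M N : rep) := NatTrans {
  nt_fun :> forall p : P, 'Hom(M p, N p);
  nt_natural : forall (s t : P) (h : (s <= t)%O),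
    (rep_map N h \o nt_fun s = nt_fun t \o rep_map M h)%VF
}.

Lemma nat_transP (M N : rep) (f g : nat_trans M N) :
  (forall p, f p = g p) -> f = g.
Proof.
case: f g => [f fn] [g gn] /= fg.
have {}fg : f = g by apply: functional_extensionality_dep.
by subst g; congr NatTrans; apply: Prop_irrelevance.
Qed.

Section Zmod.
Variables M N : rep.

Fact nt_zero_natural (s t : P) (h : (s <= t)%O) :
  (rep_map N h \o (0 : 'Hom(M s, N s)) =
   (0 : 'Hom(M t, N t)) \o rep_map M h)%VF.
Proof. by rewrite comp_lfun0r comp_lfun0l. Qed.
Definition nt_zero : nat_trans M N := NatTrans nt_zero_natural.

Fact nt_opp_natural (f : nat_trans M N) (s t : P) (h : (s <= t)%O) :
  (rep_map N h \o (- f s) = (- f t) \o rep_map M h)%VF.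
Proof. by rewrite comp_lfunNr comp_lfunNl nt_natural. Qed.
Definition nt_opp (f : nat_trans M N) : nat_trans M N :=
  NatTrans (nt_opp_natural f).

Fact nt_add_natural (f g : nat_trans M N) (s t : P) (h : (s <= t)%O) :
  (rep_map N h \o (f s + g s) = (f t + g t) \o rep_map M h)%VF.
Proof. by rewrite comp_lfunDr comp_lfunDl !nt_natural. Qed.
Definition nt_add (f g : nat_trans M N) : nat_trans M N :=
  NatTrans (nt_add_natural f g).

Fact nt_addA : associative nt_add.
Proof. by move=> f g h; apply: nat_transP => p /=; rewrite addrA. Qed.
Fact nt_addC : commutative nt_add.
Proof. by move=> f g; apply: nat_transP => p /=; rewrite addrC. Qed.
Fact nt_add0 : left_id nt_zero nt_add.
Proof. by move=> f; apply: nat_transP => p /=; rewrite add0r. Qed.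
Fact nt_addN : left_inverse nt_zero nt_opp nt_add.
Proof. by move=> f; apply: nat_transP => p /=; rewrite addNr. Qed.

HB.instance Definition _ := gen_eqMixin (nat_trans M N).
HB.instance Definition _ := gen_choiceMixin (nat_trans M N).
HB.instance Definition _ :=
  GRing.isZmodule.Build (nat_trans M N) nt_addA nt_addC nt_add0 nt_addN.

End Zmod.

Fact nt_id_natural (M : rep) (s t : P) (h : (s <= t)%O) :
  (rep_map M h \o \1 = \1 \o rep_map M h)%VF.
Proof. by rewrite comp_lfun1l comp_lfun1r. Qed.
Definition nt_id (M : rep) : nat_trans M M := NatTrans (@nt_id_natural M).

Fact nt_comp_natural (L M N : rep) (g : nat_trans M N) (f : nat_trans L M)
    (s t : P) (h : (s <= t)%O) :
  (rep_map N h \o (g s \o f s) = (g t \o f t) \o rep_map L h)%VF.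
Proof. by rewrite comp_lfunA nt_natural -comp_lfunA nt_natural comp_lfunA. Qed.
Definition nt_comp (L M N : rep) (g : nat_trans M N) (f : nat_trans L M) :
  nat_trans L N := NatTrans (nt_comp_natural g f).

Fact nt_comp_idl (M N : rep) (f : nat_trans M N) : nt_comp (nt_id N) f = f.
Proof. by apply: nat_transP => p /=; rewrite comp_lfun1l. Qed.
Fact nt_comp_idr (M N : rep) (f : nat_trans M N) : nt_comp f (nt_id M) = f.
Proof. by apply: nat_transP => p /=; rewrite comp_lfun1r. Qed.
Fact nt_compA (K L M N : rep) (h : nat_trans M N) (g : nat_trans L M)
    (f : nat_trans K L) : nt_comp h (nt_comp g f) = nt_comp (nt_comp h g) f.
Proof. by apply: nat_transP => p /=; rewrite comp_lfunA. Qed.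
Fact nt_compDl (L M N : rep) (g1 g2 : nat_trans M N) (f : nat_trans L M) :
  nt_comp (g1 + g2) f = nt_comp g1 f + nt_comp g2 f.
Proof. by apply: nat_transP => p /=; rewrite comp_lfunDl. Qed.
Fact nt_compDr (L M N : rep) (g : nat_trans M N) (f1 f2 : nat_trans L M) :
  nt_comp g (f1 + f2) = nt_comp g f1 + nt_comp g f2.
Proof. by apply: nat_transP => p /=; rewrite comp_lfunDr. Qed.

Definition rep_cat : preadditive :=
  @Preadditive rep (fun M N => nat_trans M N) nt_id nt_comp
    nt_comp_idl nt_comp_idr nt_compA nt_compDl nt_compDr.

Definition Rk (M : rep) (s t : P) (h : (s <= t)%O) : nat :=
  \dim (limg (rep_map M h)).

(* exactness of 0 -> A -> B -> C -> 0; kernels and images of morphisms of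
   representations are computed pointwise *)
Definition short_exact (A B C : rep) (f : nat_trans A B) (g : nat_trans B C) :=
  forall p : P, [/\ lker (f p) = 0%VS, limg (f p) = lker (g p)
                  & limg (g p) = fullv].

Definition rank_exact : seq_class rep_cat :=
  fun (A B C : rep) (f : nat_trans A B) (g : nat_trans B C) =>
    short_exact f g /\
    forall (s t : P) (h : (s <= t)%O), Rk B h = (Rk A h + Rk C h)%N.

Definition convex (I : pred P) : Prop :=
  forall s t u : P, (s <= t)%O -> (t <= u)%O -> I s -> I u -> I t.

Definition ind_obj (b : bool) : vectType k :=
  if b then (k^o : vectType k) else ('rV[k]_0 : vectType k).

Definition ind_map (b c : bool) : 'Hom(ind_obj b, ind_obj c) :=
  match b, c return 'Hom(ind_obj b, ind_obj c) with
  | true, true => \1%VF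
  | _, _ => 0
  end.

Section Indicator.
Variables (I : pred P) (convI : convex I).

Fact ind_map_id (s : P) (_ : (s <= s)%O) : ind_map (I s) (I s) = \1%VF.
Proof.
case: (I s) => //=; apply/lfunP => v.
by rewrite lfunE id_lfunE; apply/rowP => -[].
Qed.

Fact ind_map_comp (s t u : P) (st : (s <= t)%O) (tu : (t <= u)%O)
    (_ : (s <= u)%O) :
  ind_map (I s) (I u) = (ind_map (I t) (I u) \o ind_map (I s) (I t))%VF.
Proof.
have := convI st tu.
case: (I s); case: (I t); case: (I u) => /= Itt;
  rewrite ?comp_lfun1l ?comp_lfun0l ?comp_lfun0r //.
by have := Itt isT isT.
Qed.

Definition ind_rep : rep :=
  @Rep (fun p => ind_obj (I p)) (fun s t _ => ind_map (I s) (I t))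
    ind_map_id ind_map_comp.

End Indicator.

(* An element of P with +oo adjoined is an [option P], [None] being +oo. *)
Definition before_pinfty (i : P) (j : option P) : bool :=
  if j is Some j then (i < j)%O else true.

Definition lower_hook (i : P) (j : option P) : pred P :=
  fun l => (i <= l)%O && (if j is Some j then ~~ (j <= l)%O else true).

Lemma lower_hook_convex (i : P) (j : option P) : convex (lower_hook i j).
Proof.
move=> s t u st tu /andP[is_ _] /andP[_ ju].
rewrite /lower_hook (le_trans is_ st) /=.
by case: j ju => // j; apply: contra => /le_trans; apply.
Qed.

Definition lower_hook_rep (i : P) (j : option P) : rep :=
  ind_rep (@lower_hook_convex i j).

(* For upper hooks, [None] is -oo. *)
Definition after_ninfty (i : option P) (j : P) : bool :=
  if i is Some i then (i < j)%O else true.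

Definition upper_hook (i : option P) (j : P) : pred P :=
  fun l => (if i is Some i then ~~ (l <= i)%O else true) && (l <= j)%O.

Lemma upper_hook_convex (i : option P) (j : P) : convex (upper_hook i j).
Proof.
move=> s t u st tu /andP[si _] /andP[_ uj].
rewrite /upper_hook (le_trans tu uj) andbT.
by case: i si => // i; apply: contra; apply: le_trans.
Qed.

Definition upper_hook_rep (i : option P) (j : P) : rep :=
  ind_rep (@upper_hook_convex i j).

End Rep.

(* Main.v *)
(** For a short exact sequence [0 -> A -> B -> D -> 0] with maps [f] and [g],
    counting dimensions in [im B(s,t)] shows that
    [Rk B = Rk A + Rk D] at [(s,t)] iff [f(A t) :&: im B(s,t) = f(im A(s,t))], and
    a diagram chase shows that this holds iff [ker B(s,t) -> ker D(s,t)] is onto.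
    The first condition only involves [f], the second only [g]; so they
    characterise admissible monics, resp. epics, as injections that reflect
    images, resp. surjections that lift kernels.  Both properties are stable
    under composition and pass to the appropriate factor of a composite.

    A map from the lower hook at [i < j] to [D] is an element of
    [ker D(i,j)], which lifts along an admissible epic.  A map from [A] to the
    upper hook at [i < j] is a functional on [A j] vanishing on [im A(i,j)],
    which extends along an admissible monic. *)
From HB Require Import structures.
Require Import Defs.
From mathcomp Require Import all_boot all_order all_algebra.
From mathcomp Require Import boolp.

Set Implicit Arguments.
Unset Strict Implicit.
Unset Printing Implicit Defensive.

Import Order.TTheory GRing.Theory.
Local Open Scope ring_scope.

(** * Preadditive categories: biproducts, pushouts, pullbacks and lifting problems *)

Section Preadditive.
Local Open Scope preadditive_scope.
Variable C : preadditive.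

Lemma ccomp0l (X Y Z : C) (f : mor X Y) : (0 : mor Y Z) \oc f = 0.
Proof. by apply: (addrI (0 \oc f)); rewrite -ccompDl !addr0. Qed.

Lemma ccomp0r (X Y Z : C) (g : mor Y Z) : g \oc (0 : mor X Y) = 0.
Proof. by apply: (addrI (g \oc 0)); rewrite -ccompDr !addr0. Qed.

Lemma ccompNl (X Y Z : C) (g : mor Y Z) (f : mor X Y) : (- g) \oc f = - (g \oc f).
Proof. by apply: (addrI (g \oc f)); rewrite -ccompDl !subrr ccomp0l. Qed.

Lemma ccompNr (X Y Z : C) (g : mor Y Z) (f : mor X Y) : g \oc (- f) = - (g \oc f).
Proof. by apply: (addrI (g \oc f)); rewrite -ccompDr !subrr ccomp0r. Qed.

Lemma ccompBl (X Y Z : C) (g1 g2 : mor Y Z) (f : mor X Y) :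
  (g1 - g2) \oc f = (g1 \oc f) - (g2 \oc f).
Proof. by rewrite ccompDl ccompNl. Qed.

Lemma ccompBr (X Y Z : C) (g : mor Y Z) (f1 f2 : mor X Y) :
  g \oc (f1 - f2) = (g \oc f1) - (g \oc f2).
Proof. by rewrite ccompDr ccompNr. Qed.

Lemma ccomp_suml (X Y Z : C) n (g : 'I_n -> mor Y Z) (f : mor X Y) :
  (\sum_(a < n) g a) \oc f = \sum_(a < n) (g a \oc f).
Proof.
by apply: (big_morph (fun g : mor Y Z => g \oc f)) => [? ?|]; rewrite ?ccompDl ?ccomp0l.
Qed.

Lemma ccomp_sumr (X Y Z : C) n (g : mor Y Z) (f : 'I_n -> mor X Y) :
  g \oc (\sum_(a < n) f a) = \sum_(a < n) (g \oc f a).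
Proof.
by apply: (big_morph (fun f : mor X Y => g \oc f)) => [? ?|]; rewrite ?ccompDr ?ccomp0r.
Qed.

Record biproduct (Y1 Y2 X : C) (i1 : mor Y1 X) (i2 : mor Y2 X)
    (p1 : mor X Y1) (p2 : mor X Y2) : Prop := Biproduct {
  biprod11 : p1 \oc i1 = idmor Y1;
  biprod22 : p2 \oc i2 = idmor Y2;
  biprod12 : p1 \oc i2 = 0;
  biprod21 : p2 \oc i1 = 0;
  biprod_sum : (i1 \oc p1) + (i2 \oc p2) = idmor X
}.

Section Biproduct.
Variables (Y1 Y2 X : C) (i1 : mor Y1 X) (i2 : mor Y2 X).
Variables (p1 : mor X Y1) (p2 : mor X Y2).
Hypothesis bip : biproduct i1 i2 p1 p2.

(** A pair [a], [b] with [a \oc f = b \oc h] amounts to a map [(a \oc p1) + (b \oc p2)] out of the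
    biproduct that kills [(i1 \oc f) - (i2 \oc h)], so the two universal properties coincide. *)
Lemma pushout_cokernel (A Q : C) (f : mor A Y1) (h : mor A Y2) (q : mor X Q) :
  is_cokernel ((i1 \oc f) - (i2 \oc h)) q -> is_pushout f h (q \oc i2) (q \oc i1).
Proof.
case=> q0 uniq_q; split.
  by apply/eqP; rewrite -subr_eq0 -!ccompA -ccompBr q0.
move=> W a b ab.
have [|u [uq u_uniq]] := uniq_q W ((a \oc p1) + (b \oc p2)).
  rewrite ccompDl !ccompBr -!ccompA.
  rewrite ![_ \oc (i1 \oc _)]ccompA ![_ \oc (i2 \oc _)]ccompA.
  rewrite (biprod11 bip) (biprod22 bip) (biprod12 bip) (biprod21 bip).
  by rewrite !ccomp0l !ccomp0r !ccomp_idl subr0 sub0r ab subrr.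
exists u; split.
  rewrite !ccompA uq !ccompDl -!ccompA.
  rewrite (biprod11 bip) (biprod22 bip) (biprod12 bip) (biprod21 bip).
  by rewrite !ccomp_idr !ccomp0r addr0 add0r.
move=> v [va vb]; apply: u_uniq.
by rewrite -[v \oc q]ccomp_idr -(biprod_sum bip) ccompDr -va -vb !ccompA.
Qed.

(** Dually, a compatible pair [a], [b] amounts to the map [(i1 \oc a) + (i2 \oc b)] into the
    biproduct, killed by [(g \oc p1) - (h \oc p2)]. *)
Lemma pullback_kernel (A K : C) (g : mor Y1 A) (h : mor Y2 A) (m : mor K X) :
  is_kernel m ((g \oc p1) - (h \oc p2)) -> is_pullback g h (p2 \oc m) (p1 \oc m).
Proof.
case=> m0 uniq_m; split.
  by apply/eqP; rewrite -subr_eq0 !ccompA -ccompBl m0.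
move=> W a b ab.
have [|u [uq u_uniq]] := uniq_m W ((i1 \oc a) + (i2 \oc b)).
  rewrite ccompDr !ccompBl -!ccompA.
  rewrite ![p1 \oc (_ \oc _)]ccompA ![p2 \oc (_ \oc _)]ccompA.
  rewrite (biprod11 bip) (biprod22 bip) (biprod12 bip) (biprod21 bip).
  by rewrite !ccomp0l !ccomp0r !ccomp_idl subr0 sub0r ab subrr.
exists u; split.
  rewrite -!ccompA uq !ccompDr !ccompA.
  rewrite (biprod11 bip) (biprod22 bip) (biprod12 bip) (biprod21 bip).
  by rewrite !ccomp_idl !ccomp0l addr0 add0r.
move=> v [va vb]; apply: u_uniq.
by rewrite -[m \oc v]ccomp_idl -(biprod_sum bip) ccompDl -va -vb !ccompA.
Qed.

End Biproduct.

(** The injections and projections of a direct sum have types depending on the index, so extending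
    such a family by one member takes a transport along the equation given by [unliftP]. *)
Definition ord_rect n (T : 'I_n.+1 -> Type) (t0 : T ord0)
    (t : forall a, T (lift ord0 a)) (a : 'I_n.+1) : T a :=
  match unliftP ord0 a with
  | UnliftSome b e => ecast a (T a) (esym e) (t b)
  | UnliftNone e => ecast a (T a) (esym e) t0
  end.

Lemma ord_rect0 n (T : 'I_n.+1 -> Type) t0 t : @ord_rect n T t0 t ord0 = t0.
Proof.
rewrite /ord_rect; case: unliftP => [b e|e]; first by case/eqP: (neq_lift ord0 b).
by rewrite (eq_irrelevance e (erefl _)).
Qed.

Lemma ord_rect_lift n (T : 'I_n.+1 -> Type) t0 t a :
  @ord_rect n T t0 t (lift ord0 a) = t a.
Proof.
rewrite /ord_rect; case: unliftP => [b e|e].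
  have ab := lift_inj e; subst b.
  by rewrite (eq_irrelevance e (erefl _)).
by case/eqP: (neq_lift ord0 a).
Qed.

(** Induction on the number of summands: the first one is paired, in a biproduct, with a direct sum
    of the others. The zero object serves the empty family. *)
Lemma additive_biproduct :
  (exists Z : C, idmor Z = 0) ->
  (forall Y1 Y2 : C, exists X i1 i2 p1 p2,
     @biproduct Y1 Y2 X i1 i2 p1 p2) ->
  additive_category C.
Proof.
move=> [Z Z0] bip; elim=> [|n IHn] Y.
  exists Z, (fun=> 0), (fun=> 0); split; [by case | by case |].
  by rewrite big_ord0 Z0.
have [X' [inj [proj [pi_id pi_0 ip_sum]]]] := IHn (fun a => Y (lift ord0 a)).
have [X [i1 [i2 [p1 [p2 [e11 e22 e12 e21 esum]]]]]] := bip (Y ord0) X'.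
pose I := ord_rect (T := fun a => mor (Y a) X) i1 (fun a => i2 \oc inj a).
pose J := ord_rect (T := fun a => mor X (Y a)) p1 (fun a => proj a \oc p2).
have I0 : I ord0 = i1 by exact: ord_rect0.
have J0 : J ord0 = p1 by exact: ord_rect0.
have IS a : I (lift ord0 a) = i2 \oc inj a by exact: ord_rect_lift.
have JS a : J (lift ord0 a) = proj a \oc p2 by exact: ord_rect_lift.
have mid a b : proj b \oc p2 \oc (i2 \oc inj a) = proj b \oc inj a.
  by rewrite -ccompA [p2 \oc _]ccompA e22 ccomp_idl.
exists X, I, J; split.
- move=> a; case: (unliftP ord0 a) => [a'|] ->; last by rewrite I0 J0.
  by rewrite IS JS mid pi_id.
- move=> a b; case: (unliftP ord0 a) => [a'|] ->; case: (unliftP ord0 b) => [b'|] ->.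
  + by rewrite (inj_eq lift_inj) => ab; rewrite IS JS mid pi_0.
  + by move=> _; rewrite IS J0 ccompA e12 ccomp0l.
  + by move=> _; rewrite I0 JS -ccompA e21 ccomp0r.
  + by rewrite eqxx.
- rewrite big_ord_recl I0 J0 -esum; congr (_ + _).
  rewrite -[p2]ccomp_idl -ip_sum ccomp_suml ccomp_sumr.
  by apply: eq_bigr => a _; rewrite IS JS !ccompA.
Qed.

(** [Hom(X,-)] is left exact on any kernel, so surjectivity of composition with [g] is all that
    remains to be checked. *)
Lemma projective_wrt_lift (E : seq_class C) (X : C) :
  (forall (A B D : C) (f : mor A B) (g : mor B D), E A B D f g -> is_kernel f g) ->
  (forall (A B D : C) (f : mor A B) (g : mor B D), E A B D f g ->
     forall w : mor X D, exists v : mor X B, g \oc v = w) ->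
  projective_wrt E X.
Proof.
move=> kerE liftE A B D f g fg; have [gf0 ker_f] := kerE _ _ _ _ _ fg.
split=> [u v uv|v|]; last exact: liftE fg.
- have [|w [_ w_uniq]] := ker_f X (f \oc u); first by rewrite ccompA gf0 ccomp0l.
  by rewrite -(w_uniq u) // -(w_uniq v).
- split=> [gv0|[u <-]]; last by rewrite ccompA gf0 ccomp0l.
  by have [w [fw _]] := ker_f X v gv0; exists w.
Qed.

Lemma injective_wrt_extend (E : seq_class C) (X : C) :
  (forall (A B D : C) (f : mor A B) (g : mor B D), E A B D f g -> is_cokernel f g) ->
  (forall (A B D : C) (f : mor A B) (g : mor B D), E A B D f g ->
     forall w : mor A X, exists v : mor B X, v \oc f = w) ->
  injective_wrt E X.
Proof.
move=> cokE extE A B D f g fg; have [gf0 cok_g] := cokE _ _ _ _ _ fg.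
split=> [u v uv|v|]; last exact: extE fg.
- have [|w [_ w_uniq]] := cok_g X (u \oc g); first by rewrite -ccompA gf0 ccomp0r.
  by rewrite -(w_uniq u) // -(w_uniq v).
- split=> [vf0|[u <-]]; last by rewrite -ccompA gf0 ccomp0r.
  by have [w [wg _]] := cok_g X v vf0; exists w.
Qed.

(** Each restriction [w \oc inj a] is lifted separately; the chosen lifts are glued by the
    projections. *)
Lemma direct_sum_lift n (Y : 'I_n -> C) (X B D : C) (g : mor B D) :
  is_direct_sum Y X ->
  (forall a (w : mor (Y a) D), exists v : mor (Y a) B, g \oc v = w) ->
  forall w : mor X D, exists v : mor X B, g \oc v = w.
Proof.
move=> [inj [proj [_ _ ip_sum]]] liftY w.
pose v a := cid (liftY a (w \oc inj a)).
exists (\sum_(a < n) (sval (v a) \oc proj a)).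
rewrite -[RHS]ccomp_idr -ip_sum !ccomp_sumr; apply: eq_bigr => a _.
by rewrite !ccompA (svalP (v a)).
Qed.

Lemma direct_sum_extend n (Y : 'I_n -> C) (X A B : C) (f : mor A B) :
  is_direct_sum Y X ->
  (forall a (w : mor A (Y a)), exists v : mor B (Y a), v \oc f = w) ->
  forall w : mor A X, exists v : mor B X, v \oc f = w.
Proof.
move=> [inj [proj [_ _ ip_sum]]] extY w.
pose v a := cid (extY a (proj a \oc w)).
exists (\sum_(a < n) (inj a \oc sval (v a))).
rewrite -[RHS]ccomp_idl -ip_sum !ccomp_suml; apply: eq_bigr => a _.
by rewrite -!ccompA (svalP (v a)).
Qed.

End Preadditive.

(** * Linear algebra: factorisations, quotients and extension of linear maps *)

Section LinearAlgebra.
Variable k : fieldType.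

Lemma lfun_inv_ker (U V : vectType k) (f : 'Hom(U, V)) x :
  f (f^-1%VF (f x)) = f x.
Proof. by rewrite limg_lfunVK // memv_img // memvf. Qed.

(** The vectors [x] and [h^-1 (h x)] differ by an element of [lker h], which [e] kills. *)
Lemma lfun_factor (U V W : vectType k) (h : 'Hom(U, V)) (e : 'Hom(U, W)) :
  (lker h <= lker e)%VS -> ((e \o h^-1) \o h)%VF = e.
Proof.
move/subvP=> he; apply/lfunP=> x; rewrite !comp_lfunE; apply/eqP.
by rewrite -subr_eq0 -linearB -memv_ker he // memv_ker linearB /= lfun_inv_ker subrr.
Qed.

(** The quotient by [U] is modelled on the complement [U^C], the class of [v] being
    [v - projv U v]. *)
Lemma quotient_exists (V : vectType k) (U : {vspace V}) :
  exists (Q : vectType k) (q : 'Hom(V, Q)), limg q = fullv /\ lker q = U.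
Proof.
pose q : 'Hom(V, subvs_of U^C) := (linfun (vsproj _) \o (\1 - projv U))%VF.
have qE v : vsval (q v) = v - projv U v.
  by rewrite comp_lfunE lfunE /= vsprojK !lfunE /= ?lfunE // memv_projC.
exists (subvs_of U^C), q; split.
  apply/eqP; rewrite eqEsubv subvf /=; apply/subvP=> w _.
  have -> : w = q (vsval w); last by rewrite memv_img ?memvf.
  apply: subvs_inj; rewrite qE.
  have : vsval w \in lker (projv U) by rewrite lker_proj subvsP.
  by rewrite memv_ker => /eqP ->; rewrite subr0.
apply/vspaceP=> v; rewrite memv_ker -(inj_eq subvs_inj) qE linear0 subr_eq0.
by apply/eqP/idP=> [->|/projv_id //]; rewrite memv_proj.
Qed.

Section Pair.
Variables U V : vectType k.

Definition pair_inl (u : U) : U * V := (u, 0).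
Definition pair_inr (v : V) : U * V := (0, v).

Fact pair_inl_linear : linear pair_inl.
Proof. by move=> c u v; congr pair; rewrite /= scaler0 addr0. Qed.
Fact pair_inr_linear : linear pair_inr.
Proof. by move=> c u v; congr pair; rewrite /= scaler0 addr0. Qed.

HB.instance Definition _ :=
  GRing.isLinear.Build k U (U * V)%type _ pair_inl pair_inl_linear.
HB.instance Definition _ :=
  GRing.isLinear.Build k V (U * V)%type _ pair_inr pair_inr_linear.

End Pair.

Definition scale_line (V : vectType k) (v : V) (c : k^o) : V := c *: v.

Fact scale_line_linear (V : vectType k) (v : V) : linear (scale_line v).
Proof. by move=> c x y; rewrite /scale_line scalerDl scalerA. Qed.

HB.instance Definition _ (V : vectType k) (v : V) :=
  GRing.isLinear.Build k k^o V _ (scale_line v) (scale_line_linear v).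

(** Let [h] send [(a, z)] to [f a + m z]. Applied to [a] and [- z], the hypothesis says that
    [(a, z) |-> e a] vanishes on the kernel of [h], hence factors through [h]; the two conclusions
    are read off on the factors [A] and [Z]. *)
Lemma functional_extend (A B Z W : vectType k) (f : 'Hom(A, B)) (m : 'Hom(Z, B))
    (e : 'Hom(A, W)) :
  (forall a z, f a = m z -> e a = 0) ->
  exists e' : 'Hom(B, W), (e' \o f = e)%VF /\ (e' \o m = 0)%VF.
Proof.
move=> fm.
pose h : 'Hom((A * Z)%type, B) := ((f \o linfun fst) + (m \o linfun snd))%VF.
pose e1 : 'Hom((A * Z)%type, W) := (e \o linfun fst)%VF.
have hE x : h x = f x.1 + m x.2.
  by rewrite add_lfunE !comp_lfunE; congr (f _ + m _); rewrite lfunE.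
have e1E x : e1 x = e x.1 by rewrite comp_lfunE; congr (e _); rewrite lfunE.
have eE x : (e1 \o h^-1)%VF (f x.1 + m x.2) = e x.1.
  rewrite -hE -comp_lfunE lfun_factor ?e1E //; apply/subvP=> y.
  rewrite !memv_ker hE e1E addr_eq0 -linearN => /eqP/fm ->.
  by rewrite eqxx.
exists (e1 \o h^-1)%VF; split; apply/lfunP=> x; rewrite comp_lfunE.
  by have := eE (x, 0); rewrite /= linear0 addr0.
by have := eE (0, x); rewrite /= !linear0 add0r zero_lfunE.
Qed.

End LinearAlgebra.

(** * Morphisms of representations, handled elementwise *)

Section Rep.
Context {d : Order.disp_t} (P : porderType d) (k : fieldType).
Implicit Types A B D M N X Y Z W : rep P k.

Lemma rep_map_idE M s (h : (s <= s)%O) x : rep_map M h x = x.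
Proof. by rewrite rep_map_id id_lfunE. Qed.

Lemma rep_map_compE M s t u (st : (s <= t)%O) (tu : (t <= u)%O) (su : (s <= u)%O) x :
  rep_map M tu (rep_map M st x) = rep_map M su x.
Proof. by rewrite (rep_map_comp M st tu su) comp_lfunE. Qed.

Lemma nt_naturalE M N (f : nat_trans M N) s t (h : (s <= t)%O) x :
  rep_map N h (f s x) = f t (rep_map M h x).
Proof. by rewrite -!comp_lfunE nt_natural. Qed.

Lemma nt_compE L M N (g : nat_trans M N) (f : nat_trans L M) p x :
  nt_comp g f p x = g p (f p x).
Proof. by rewrite comp_lfunE. Qed.

Lemma nat_trans_eqE M N (f g : nat_trans M N) : f = g -> forall p x, f p x = g p x.
Proof. by move=> ->. Qed.

Lemma nat_trans_ext M N (f g : nat_trans M N) : (forall p x, f p x = g p x) -> f = g.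
Proof. by move=> fg; apply: nat_transP => p; apply/lfunP. Qed.

Definition pointwise_inj A B (f : nat_trans A B) := forall p x, f p x = 0 -> x = 0.
Definition pointwise_surj B D (g : nat_trans B D) := forall p y, exists x, g p x = y.

Lemma pointwise_injI A B (f : nat_trans A B) p x y :
  pointwise_inj f -> f p x = f p y -> x = y.
Proof.
move=> f_inj fxy; apply/eqP; rewrite -subr_eq0; apply/eqP/(f_inj p).
by rewrite linearB /= fxy subrr.
Qed.

Lemma pointwise_injP A B (f : nat_trans A B) :
  pointwise_inj f <-> forall p, lker (f p) = 0%VS.
Proof.
split=> [f_inj p|ker0 p x fx0].
  apply/eqP; rewrite -subv0; apply/subvP=> x; rewrite memv_ker => /eqP/f_inj ->.
  exact: mem0v.
by apply/eqP; rewrite -memv0 -(ker0 p) memv_ker fx0.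
Qed.

Lemma pointwise_surjP B D (g : nat_trans B D) :
  pointwise_surj g <-> forall p, limg (g p) = fullv.
Proof.
split=> [g_surj p|img p y].
  apply/eqP; rewrite eqEsubv subvf; apply/subvP=> y _.
  by have [x <-] := g_surj p y; rewrite memv_img ?memvf.
have : y \in limg (g p) by rewrite img memvf.
by case/memv_imgP=> x _ ->; exists x.
Qed.

Lemma short_exactP A B D (f : nat_trans A B) (g : nat_trans B D) :
  short_exact f g <->
  [/\ pointwise_inj f, pointwise_surj g
    & forall p y, g p y = 0 <-> exists x, f p x = y].
Proof.
split=> [fg|[/pointwise_injP f_inj /pointwise_surjP g_surj ex] p].
  split=> [||p y]; first by apply/pointwise_injP => p; case: (fg p).
    by apply/pointwise_surjP => p; case: (fg p).
  have [_ img _] := fg p; split=> [gy|[x <-]].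
    have : y \in limg (f p) by rewrite img memv_ker gy.
    by case/memv_imgP=> x _ ->; exists x.
  by apply/eqP; rewrite -memv_ker -img memv_img ?memvf.
split=> //; apply/vspaceP=> y; rewrite memv_ker.
apply/memv_imgP/eqP=> [[x _ ->]|/ex[x <-]]; last by exists x; rewrite ?memvf.
by apply/ex; exists x.
Qed.

(** Preimages under [f] are taken point by point; injectivity makes them natural and unique. *)
Lemma nat_trans_lift A B W (f : nat_trans A B) (h : nat_trans W B) :
  pointwise_inj f -> (forall p w, exists a, f p a = h p w) ->
  exists! u : nat_trans W A, nt_comp f u = h.
Proof.
move=> f_inj fh.
have fu p w : f p (((f p)^-1 \o h p)%VF w) = h p w.
  by rewrite comp_lfunE; have [a <-] := fh p w; rewrite lfun_inv_ker.
have natural s t (st : (s <= t)%O) :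
    (rep_map A st \o ((f s)^-1 \o h s) = ((f t)^-1 \o h t) \o rep_map W st)%VF.
  apply/lfunP=> w; rewrite comp_lfunE [RHS]comp_lfunE.
  by apply: (pointwise_injI f_inj); rewrite -nt_naturalE !fu nt_naturalE.
exists (NatTrans natural); split=> [|v fv].
  by apply: nat_trans_ext => p w; rewrite nt_compE fu.
apply: nat_trans_ext => p w; apply: (pointwise_injI f_inj).
by rewrite fu -fv nt_compE.
Qed.

(** Point by point, [h] factors through [g]; surjectivity of [g] gives naturality and uniqueness. *)
Lemma nat_trans_desc B D W (g : nat_trans B D) (h : nat_trans B W) :
  pointwise_surj g -> (forall p b, g p b = 0 -> h p b = 0) ->
  exists! u : nat_trans D W, nt_comp u g = h.
Proof.
move=> g_surj gh.
have ug p b : (h p \o (g p)^-1)%VF (g p b) = h p b.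
  rewrite -comp_lfunE lfun_factor //; apply/subvP=> x; rewrite !memv_ker.
  by move/eqP/gh->.
have natural s t (st : (s <= t)%O) :
    (rep_map W st \o (h s \o (g s)^-1) = (h t \o (g t)^-1) \o rep_map D st)%VF.
  apply/lfunP=> y; have [b <-] := g_surj s y.
  by rewrite comp_lfunE [RHS]comp_lfunE ug !nt_naturalE ug.
exists (NatTrans natural); split=> [|v vg].
  by apply: nat_trans_ext => p w; rewrite nt_compE ug.
apply: nat_trans_ext => p y; have [b <-] := g_surj p y.
by rewrite ug -vg nt_compE.
Qed.

Lemma short_exact_kernel A B D (f : nat_trans A B) (g : nat_trans B D) :
  short_exact f g -> @is_kernel (rep_cat P k) A B D f g.
Proof.
move=> /short_exactP[f_inj _ ex]; split.
  by apply: nat_trans_ext => p x; rewrite nt_compE lfunE /=; apply/ex; exists x.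
move=> W h gh; apply: nat_trans_lift => // p w; apply/ex.
by rewrite -nt_compE (nat_trans_eqE gh) lfunE.
Qed.

Lemma short_exact_cokernel A B D (f : nat_trans A B) (g : nat_trans B D) :
  short_exact f g -> @is_cokernel (rep_cat P k) A B D f g.
Proof.
move=> /short_exactP[_ g_surj ex]; split.
  by apply: nat_trans_ext => p x; rewrite nt_compE lfunE /=; apply/ex; exists x.
move=> W h hf; apply: nat_trans_desc => // p b /ex[a <-].
by rewrite -nt_compE (nat_trans_eqE hf) lfunE.
Qed.

(** * Subrepresentations, quotients, kernels, cokernels and biproducts *)

Lemma subrep_exists B (U : forall p, {vspace B p}) :
  (forall s t (h : (s <= t)%O) x, x \in U s -> rep_map B h x \in U t) ->
  exists A (f : nat_trans A B),
    pointwise_inj f /\ forall p y, y \in U p <-> exists x, f p x = y.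
Proof.
move=> U_stable.
pose i p : 'Hom(subvs_of (U p), B p) := linfun vsval.
have iE p x : i p x = vsval x by rewrite lfunE.
pose r s t (h : (s <= t)%O) : 'Hom(subvs_of (U s), subvs_of (U t)) :=
  (linfun (vsproj _) \o (rep_map B h \o i s))%VF.
have rE s t (h : (s <= t)%O) x : vsval (r s t h x) = rep_map B h (vsval x).
  by rewrite !comp_lfunE lfunE /= vsprojK iE // U_stable // subvsP.
have r_id s (h : (s <= s)%O) : r s s h = \1%VF.
  by apply/lfunP=> x; apply: subvs_inj; rewrite rE rep_map_idE id_lfunE.
have r_comp s t u (st : (s <= t)%O) (tu : (t <= u)%O) (su : (s <= u)%O) :
    r s u su = (r t u tu \o r s t st)%VF.
  apply/lfunP=> x; apply: subvs_inj.
  by rewrite comp_lfunE !rE (rep_map_compE st tu su).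
pose A := @Rep d P k (fun p => subvs_of (U p)) r r_id r_comp.
have natural s t (h : (s <= t)%O) : (rep_map B h \o i s = i t \o rep_map A h)%VF.
  by apply/lfunP=> x; rewrite comp_lfunE [RHS]comp_lfunE !iE; apply/esym/rE.
exists A, (@NatTrans d P k A B i natural); split=> /= [p x|p y].
  by rewrite iE => x0; apply: subvs_inj; rewrite x0 linear0.
split=> [Uy|[x <-]]; last by rewrite iE subvsP.
by exists (vsproj _ y); rewrite iE vsprojK.
Qed.

Lemma quorep_exists B (U : forall p, {vspace B p}) :
  (forall s t (h : (s <= t)%O) x, x \in U s -> rep_map B h x \in U t) ->
  exists D (g : nat_trans B D),
    pointwise_surj g /\ forall p y, g p y = 0 <-> y \in U p.
Proof.
move=> U_stable.
pose Q p := sval (cid (quotient_exists (U p))).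
pose q p : 'Hom(B p, Q p) := sval (cid (svalP (cid (quotient_exists (U p))))).
have qP p : limg (q p) = fullv /\ lker (q p) = U p.
  exact: svalP (cid (svalP (cid (quotient_exists (U p))))).
have q_surj p y : exists x, q p x = y.
  have : y \in limg (q p) by rewrite (proj1 (qP p)) memvf.
  by case/memv_imgP=> x _ ->; exists x.
have q_ker p y : q p y = 0 <-> y \in U p.
  by rewrite -(proj2 (qP p)) memv_ker; split=> /eqP.
(* The structure map of [B] descends to the quotients because it carries [U s] into [U t]. *)
pose r s t (h : (s <= t)%O) : 'Hom(Q s, Q t) := ((q t \o rep_map B h) \o (q s)^-1)%VF.
have rE s t (h : (s <= t)%O) x : r s t h (q s x) = q t (rep_map B h x).
  rewrite -[LHS]comp_lfunE lfun_factor ?comp_lfunE //; apply/subvP=> z.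
  by rewrite !memv_ker comp_lfunE => /eqP/q_ker/(U_stable _ _ h)/q_ker ->.
have r_id s (h : (s <= s)%O) : r s s h = \1%VF.
  by apply/lfunP=> y; have [x <-] := q_surj s y; rewrite rE rep_map_idE id_lfunE.
have r_comp s t u (st : (s <= t)%O) (tu : (t <= u)%O) (su : (s <= u)%O) :
    r s u su = (r t u tu \o r s t st)%VF.
  apply/lfunP=> y; have [x <-] := q_surj s y.
  by rewrite comp_lfunE !rE (rep_map_compE st tu su).
pose D := @Rep d P k Q r r_id r_comp.
have natural s t (h : (s <= t)%O) : (rep_map D h \o q s = q t \o rep_map B h)%VF.
  by apply/lfunP=> x; rewrite comp_lfunE [RHS]comp_lfunE; apply: rE.
by exists D, (@NatTrans d P k B D q natural); split.
Qed.

Lemma kernel_exists B D (g : nat_trans B D) :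
  exists A (f : nat_trans A B), pointwise_inj f /\
    forall p y, g p y = 0 <-> exists x, f p x = y.
Proof.
have [|A [f [f_inj f_im]]] := @subrep_exists B (fun p => lker (g p)).
  by move=> s t h x; rewrite !memv_ker -nt_naturalE => /eqP ->; rewrite linear0.
exists A, f; split=> // p y; apply: iff_trans (f_im p y).
by rewrite memv_ker; split=> /eqP.
Qed.

Lemma cokernel_exists A B (f : nat_trans A B) :
  exists D (g : nat_trans B D), pointwise_surj g /\
    forall p y, g p y = 0 <-> exists x, f p x = y.
Proof.
have [|D [g [g_surj g_ker]]] := @quorep_exists B (fun p => limg (f p)).
  by move=> s t h _ /memv_imgP[x _ ->]; rewrite nt_naturalE memv_img ?memvf.
exists D, g; split=> // p y; apply: iff_trans (g_ker p y) _.
by split=> [/memv_imgP[x _ ->]|[x <-]]; [exists x | rewrite memv_img ?memvf].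
Qed.

Lemma zero_rep_exists : exists Z : rep_cat P k, idmor Z = 0.
Proof.
exists (@Rep d P k (fun=> 'rV[k]_0) (fun _ _ _ => \1%VF) (fun _ _ => erefl)
  (fun _ _ _ _ _ _ => esym (comp_lfun1l _))).
by apply: nat_trans_ext => p x; apply/rowP => -[].
Qed.

Lemma biproduct_exists (Y1 Y2 : rep_cat P k) :
  exists (X : rep_cat P k) i1 i2 p1 p2, @biproduct _ Y1 Y2 X i1 i2 p1 p2.
Proof.
pose i1 p : 'Hom(Y1 p, (Y1 p * Y2 p)%type) := linfun (@pair_inl k (Y1 p) (Y2 p)).
pose i2 p : 'Hom(Y2 p, (Y1 p * Y2 p)%type) := linfun (@pair_inr k (Y1 p) (Y2 p)).
pose p1 p : 'Hom((Y1 p * Y2 p)%type, Y1 p) := linfun fst.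
pose p2 p : 'Hom((Y1 p * Y2 p)%type, Y2 p) := linfun snd.
have i1E p y : i1 p y = (y, 0) by rewrite lfunE.
have i2E p y : i2 p y = (0, y) by rewrite lfunE.
have p1E p y : p1 p y = y.1 by rewrite lfunE.
have p2E p y : p2 p y = y.2 by rewrite lfunE.
pose r s t (h : (s <= t)%O) : 'Hom((Y1 s * Y2 s)%type, (Y1 t * Y2 t)%type) :=
  (((i1 t \o rep_map Y1 h) \o p1 s) + ((i2 t \o rep_map Y2 h) \o p2 s))%VF.
have rE s t (h : (s <= t)%O) y : r s t h y = (rep_map Y1 h y.1, rep_map Y2 h y.2).
  rewrite add_lfunE !comp_lfunE i1E i2E p1E p2E.
  by congr pair; rewrite /= ?addr0 ?add0r.
have r_id s (h : (s <= s)%O) : r s s h = \1%VF.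
  by apply/lfunP=> y; rewrite rE !rep_map_idE id_lfunE; case: y.
have r_comp s t u (st : (s <= t)%O) (tu : (t <= u)%O) (su : (s <= u)%O) :
    r s u su = (r t u tu \o r s t st)%VF.
  by apply/lfunP=> y; rewrite comp_lfunE !rE !(rep_map_compE st tu su).
pose X := @Rep d P k (fun p => (Y1 p * Y2 p)%type) r r_id r_comp.
have i1N s t (h : (s <= t)%O) : (rep_map X h \o i1 s = i1 t \o rep_map Y1 h)%VF.
  apply/lfunP=> y; rewrite comp_lfunE [RHS]comp_lfunE !i1E.
  by apply: etrans (rE _ _ _ _) _; rewrite linear0.
have i2N s t (h : (s <= t)%O) : (rep_map X h \o i2 s = i2 t \o rep_map Y2 h)%VF.
  apply/lfunP=> y; rewrite comp_lfunE [RHS]comp_lfunE !i2E.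
  by apply: etrans (rE _ _ _ _) _; rewrite linear0.
have p1N s t (h : (s <= t)%O) : (rep_map Y1 h \o p1 s = p1 t \o rep_map X h)%VF.
  by apply/lfunP=> y; rewrite comp_lfunE [RHS]comp_lfunE !p1E /= rE.
have p2N s t (h : (s <= t)%O) : (rep_map Y2 h \o p2 s = p2 t \o rep_map X h)%VF.
  by apply/lfunP=> y; rewrite comp_lfunE [RHS]comp_lfunE !p2E /= rE.
exists X, (@NatTrans d P k Y1 X i1 i1N), (@NatTrans d P k Y2 X i2 i2N),
  (@NatTrans d P k X Y1 p1 p1N), (@NatTrans d P k X Y2 p2 p2N).
split; apply: nat_trans_ext => p y /=.
- by rewrite comp_lfunE i1E p1E id_lfunE.
- by rewrite comp_lfunE i2E p2E id_lfunE.
- by rewrite comp_lfunE i2E p1E zero_lfunE.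
- by rewrite comp_lfunE i1E p2E zero_lfunE.
- rewrite add_lfunE !comp_lfunE p1E p2E i1E i2E id_lfunE.
  by case: y => y1 y2; congr pair; rewrite /= ?addr0 ?add0r.
Qed.

(** * Rank-exactness in terms of images and of kernels *)

Definition reflects_images A B (f : nat_trans A B) :=
  forall s t (h : (s <= t)%O) b a, rep_map B h b = f t a ->
    exists a', rep_map A h a' = a.

Definition lifts_kernels B D (g : nat_trans B D) :=
  forall s t (h : (s <= t)%O) y, rep_map D h y = 0 ->
    exists b, g s b = y /\ rep_map B h b = 0.

Section ShortExact.
Variables (A B D : rep P k) (f : nat_trans A B) (g : nat_trans B D).
Hypothesis fg : short_exact f g.

(** Restrict [g t] to [im B(s,t)]. Its image is [im D(s,t)] since [g s] is onto, and its kernel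
    contains [f(im A(s,t))], of dimension [Rk A] since [f t] is injective. By rank-nullity the ranks
    add up iff this containment is an equality. *)
Lemma rank_additiveP :
  (forall s t (h : (s <= t)%O), Rk B h = (Rk A h + Rk D h)%N) <->
  reflects_images f.
Proof.
have [f_inj g_surj ex] := (short_exactP f g).1 fg.
have RkD s t (h : (s <= t)%O) : (g t @: limg (rep_map B h))%VS = limg (rep_map D h).
  rewrite -limg_comp -nt_natural limg_comp.
  by have [_ _ ->] := fg s.
have RkA s t (h : (s <= t)%O) : \dim (f t @: limg (rep_map A h)) = Rk A h.
  by apply: limg_dim_eq; have [-> _ _] := fg t; rewrite capv0.
have sub s t (h : (s <= t)%O) :
    (f t @: limg (rep_map A h) <= limg (rep_map B h) :&: lker (g t))%VS.
  apply/subvP=> _ /memv_imgP[_ /memv_imgP[a _ ->] ->].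
  rewrite memv_cap memv_ker -nt_naturalE memv_img ?memvf //=.
  by rewrite nt_naturalE; apply/eqP/ex; exists (rep_map A h a).
have RkB s t (h : (s <= t)%O) : (Rk B h == Rk A h + Rk D h)%N =
    (limg (rep_map B h) :&: lker (g t) <= f t @: limg (rep_map A h))%VS.
  rewrite -[RHS](andb_idl (fun _ => sub s t h)) -eqEsubv eqEdim sub /=.
  rewrite RkA /Rk -(limg_ker_dim (g t)) RkD eqn_add2r.
  have := dimvS (sub s t h); rewrite RkA /Rk => le.
  by rewrite eqn_leq le andbT.
split=> [rk s t h b a ba|refl s t h].
  have /eqP := rk s t h; rewrite RkB => /subvP/(_ (f t a)).
  rewrite memv_cap -{1}ba memv_img ?memvf // memv_ker.
  have -> : g t (f t a) = 0 by apply/ex; exists a.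
  case/(_ (eqxx _))/memv_imgP=> _ /memv_imgP[a' _ ->] /(pointwise_injI f_inj) ->.
  by exists a'.
apply/eqP; rewrite RkB; apply/subvP=> _ /memv_capP[/memv_imgP[b _ ->]].
rewrite memv_ker => /eqP/ex[a fa]; rewrite -fa memv_img //.
by have [a' <-] := refl s t h b a (esym fa); rewrite memv_img ?memvf.
Qed.

Lemma reflects_images_lifts_kernels : reflects_images f <-> lifts_kernels g.
Proof.
have [f_inj g_surj ex] := (short_exactP f g).1 fg.
split=> [refl s t h y y0|lift s t h b a ba].
  have [b by_] := g_surj s y.
  have /ex[a fa] : g t (rep_map B h b) = 0 by rewrite -nt_naturalE by_.
  have [a' aa'] := refl s t h b a (esym fa).
  (* An arbitrary preimage [b] of [y] is corrected by an element of [A s] with the same image in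
     [B t]. *)
  exists (b - f s a'); rewrite !linearB /= by_ nt_naturalE aa' fa subrr.
  by have /ex -> : exists x, f s x = f s a'; [exists a' | rewrite subr0].
(* Conversely, [g s b] dies in [D t], so it has a preimage [b'] that dies in [B t]; then [b - b']
   comes from [A s] and has the same image in [B t] as [b]. *)
have [|b' [bb' b'0]] := lift s t h (g s b).
  by rewrite nt_naturalE ba; apply/ex; exists a.
have /ex[a' fa'] : g s (b - b') = 0 by rewrite linearB /= bb' subrr.
exists a'; apply: (pointwise_injI f_inj).
by rewrite -nt_naturalE fa' linearB /= b'0 subr0.
Qed.

End ShortExact.

Lemma rank_exact_reflects A B D (f : nat_trans A B) (g : nat_trans B D) :
  rank_exact f g <-> short_exact f g /\ reflects_images f.
Proof. by split=> -[fg rk]; split=> //; apply/(rank_additiveP fg). Qed.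

Lemma rank_exact_lifts A B D (f : nat_trans A B) (g : nat_trans B D) :
  rank_exact f g <-> short_exact f g /\ lifts_kernels g.
Proof.
apply: iff_trans (rank_exact_reflects f g) _.
by split=> -[fg rk]; split=> //; apply/(reflects_images_lifts_kernels fg).
Qed.

(** Once [f] is injective and reflects images, its cokernel completes it to a rank-exact
    sequence. *)
Lemma admissible_monicP A B (f : nat_trans A B) :
  admissible_monic (@rank_exact d P k) f <-> pointwise_inj f /\ reflects_images f.
Proof.
split=> [[D [g /rank_exact_reflects[/short_exactP[]]]]|[f_inj refl]] //.
have [D [g [g_surj ex]]] := cokernel_exists f.
by exists D, g; apply/rank_exact_reflects; split=> //; apply/short_exactP.
Qed.

Lemma admissible_epicP B D (g : nat_trans B D) :
  admissible_epic (@rank_exact d P k) g <-> pointwise_surj g /\ lifts_kernels g.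
Proof.
split=> [[A [f /rank_exact_lifts[/short_exactP[]]]]|[g_surj lift]] //.
have [A [f [f_inj ex]]] := kernel_exists g.
by exists A, f; apply/rank_exact_lifts; split=> //; apply/short_exactP.
Qed.

(** * The axioms of an exact category *)

Lemma admissible_monic_comp X Y Z (f : nat_trans X Y) (g : nat_trans Y Z) :
  admissible_monic (@rank_exact d P k) f -> admissible_monic (@rank_exact d P k) g ->
  admissible_monic (@rank_exact d P k) (nt_comp g f).
Proof.
move=> /admissible_monicP[f_inj f_refl] /admissible_monicP[g_inj g_refl].
apply/admissible_monicP; split=> [p x|s t h z x].
  by rewrite nt_compE => /g_inj/f_inj.
by rewrite nt_compE => /g_refl[y] /f_refl.
Qed.

Lemma admissible_epic_comp X Y Z (f : nat_trans X Y) (g : nat_trans Y Z) :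
  admissible_epic (@rank_exact d P k) f -> admissible_epic (@rank_exact d P k) g ->
  admissible_epic (@rank_exact d P k) (nt_comp g f).
Proof.
move=> /admissible_epicP[f_surj f_lift] /admissible_epicP[g_surj g_lift].
apply/admissible_epicP; split=> [p z|s t h z /g_lift[y [yz /f_lift[x [xy x0]]]]].
  have [y <-] := g_surj p z; have [x <-] := f_surj p y.
  by exists x; rewrite nt_compE.
by exists x; rewrite nt_compE xy.
Qed.

(* Any pushout of a monic receives from the constructed one a comparison map, so
   this lemma spares us the isomorphism between the two. *)
Lemma admissible_monic_factor X Y Z (f : nat_trans X Y) (g : nat_trans Y Z) :
  admissible_monic (@rank_exact d P k) (nt_comp g f) ->
  admissible_monic (@rank_exact d P k) f.
Proof.
move=> /admissible_monicP[gf_inj gf_refl].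
apply/admissible_monicP; split=> [p x fx|s t h y x yx].
  by apply: (gf_inj p); rewrite nt_compE fx linear0.
by apply: (gf_refl s t h (g s y)); rewrite nt_compE nt_naturalE yx.
Qed.

(** Used for an arbitrary pullback, with [f] the comparison map from the constructed pullback into
    it. *)
Lemma admissible_epic_factor X Y Z (f : nat_trans X Y) (g : nat_trans Y Z) :
  admissible_epic (@rank_exact d P k) (nt_comp g f) ->
  admissible_epic (@rank_exact d P k) g.
Proof.
move=> /admissible_epicP[gf_surj gf_lift].
apply/admissible_epicP; split=> [p z|s t h z /gf_lift[x [xz x0]]].
  by have [x] := gf_surj p z; rewrite nt_compE; exists (f p x).
by exists (f s x); rewrite nt_naturalE x0 linear0 -xz nt_compE.
Qed.

(** The pushout is the cokernel of [m = (f, -h)] into the sum of [Y] and [X']. Equations in it are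
    lifted to this sum and compared there coordinate by coordinate. *)
Lemma admissible_pushout_exists X Y X' (f : nat_trans X Y) (h : nat_trans X X') :
  admissible_monic (@rank_exact d P k) f ->
  exists Y' (f' : nat_trans X' Y') (h' : nat_trans Y Y'),
    @is_pushout (rep_cat P k) X Y X' Y' f h f' h' /\
    admissible_monic (@rank_exact d P k) f'.
Proof.
move=> /admissible_monicP[f_inj f_refl].
have [S [i1 [i2 [p1 [p2 bip]]]]] := biproduct_exists Y X'.
have p1i1 p y : p1 p (i1 p y) = y.
  by rewrite -nt_compE (nat_trans_eqE (biprod11 bip)) id_lfunE.
have p2i2 p y : p2 p (i2 p y) = y.
  by rewrite -nt_compE (nat_trans_eqE (biprod22 bip)) id_lfunE.
have p1i2 p y : p1 p (i2 p y) = 0.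
  by rewrite -nt_compE (nat_trans_eqE (biprod12 bip)) zero_lfunE.
have p2i1 p y : p2 p (i1 p y) = 0.
  by rewrite -nt_compE (nat_trans_eqE (biprod21 bip)) zero_lfunE.
pose m : nat_trans X S := nt_comp i1 f - nt_comp i2 h.
have mE p x : m p x = i1 p (f p x) - i2 p (h p x).
  by rewrite add_lfunE opp_lfunE !nt_compE.
have m_inj : pointwise_inj m.
  move=> p x /(congr1 (p1 p)); rewrite mE linearB /= p1i1 p1i2 subr0 linear0.
  exact: f_inj.
have [Y' [q [q_surj q_ker]]] := cokernel_exists m.
have mq : short_exact m q by apply/short_exactP.
exists Y', (nt_comp q i2), (nt_comp q i1); split.
  exact: (pushout_cokernel bip (short_exact_cokernel mq)).
apply/admissible_monicP; split=> [p x'|s t le y' x'].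
  rewrite nt_compE => /q_ker[x]; rewrite mE => mx.
  have x0 : x = 0.
    apply: (f_inj p); have := congr1 (p1 p) mx.
    by rewrite linearB /= p1i1 !p1i2 subr0.
  have := congr1 (p2 p) mx.
  by rewrite x0 !linear0 addr0 linear0 p2i2.
have [z <-] := q_surj s y'; rewrite nt_compE nt_naturalE => qz.
have /q_ker[x] : q t (rep_map S le z - i2 t x') = 0 by rewrite linearB /= qz subrr.
rewrite mE => mx.
(* The first coordinate puts [f t x] in the image of [Y(s,t)]; as [f] reflects images, [x] comes
   from some [x0] in [X s]. *)
have := congr1 (p1 t) mx.
rewrite !linearB /= p1i1 !p1i2 !subr0 -nt_naturalE => /esym/f_refl[x0 x0x].
(* The second coordinate expresses [x'] as the image of [p2 s z] plus [h t x], whence the preimage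
   [p2 s z + h s x0]. *)
have := congr1 (p2 t) mx.
rewrite !linearB /= p2i1 !p2i2 sub0r -nt_naturalE => x'E.
exists (p2 s z + h s x0); rewrite linearD /= (nt_naturalE h) x0x.
by rewrite -[h t x]opprK x'E opprB addrC subrK.
Qed.

(** The pullback is the kernel of [(g, -h)] on the sum of [Y] and [Z']. If [z'] dies in [Z' t], then
    [h s z'] dies in [Z t] and lifts along [g] to some [y] that dies in [Y t]; the pair [(y, z')] is
    the required lift. *)
Lemma admissible_pullback_exists Y Z Z' (g : nat_trans Y Z) (h : nat_trans Z' Z) :
  admissible_epic (@rank_exact d P k) g ->
  exists Y' (g' : nat_trans Y' Z') (h' : nat_trans Y' Y),
    @is_pullback (rep_cat P k) Y Z Z' Y' g h g' h' /\
    admissible_epic (@rank_exact d P k) g'.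
Proof.
move=> /admissible_epicP[g_surj g_lift].
have [S [i1 [i2 [p1 [p2 bip]]]]] := biproduct_exists Y Z'.
have p1i1 p y : p1 p (i1 p y) = y.
  by rewrite -nt_compE (nat_trans_eqE (biprod11 bip)) id_lfunE.
have p2i2 p y : p2 p (i2 p y) = y.
  by rewrite -nt_compE (nat_trans_eqE (biprod22 bip)) id_lfunE.
have p1i2 p y : p1 p (i2 p y) = 0.
  by rewrite -nt_compE (nat_trans_eqE (biprod12 bip)) zero_lfunE.
have p2i1 p y : p2 p (i1 p y) = 0.
  by rewrite -nt_compE (nat_trans_eqE (biprod21 bip)) zero_lfunE.
pose e : nat_trans S Z := nt_comp g p1 - nt_comp h p2.
have eE p x : e p x = g p (p1 p x) - h p (p2 p x).
  by rewrite add_lfunE opp_lfunE !nt_compE.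
have e_surj : pointwise_surj e.
  move=> p z; have [y <-] := g_surj p z; exists (i1 p y).
  by rewrite eE p1i1 p2i1 linear0 subr0.
have [Y' [m [m_inj m_im]]] := kernel_exists e.
have me : short_exact m e by apply/short_exactP.
have lift s z' y : g s y = h s z' -> exists u, m s u = i1 s y + i2 s z'.
  move=> gh; apply/m_im; rewrite eE !linearD /= p1i1 p1i2 p2i1 p2i2.
  by rewrite !linear0 addr0 add0r gh subrr.
exists Y', (nt_comp p2 m), (nt_comp p1 m); split.
  exact: (pullback_kernel bip (short_exact_kernel me)).
apply/admissible_epicP; split=> [p z'|s t le z' z'0].
  have [y /lift[u mu]] := g_surj p (h p z').
  by exists u; rewrite nt_compE mu linearD /= p2i1 p2i2 add0r.
have [|y [/lift[u mu] y0]] := g_lift s t le (h s z').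
  by rewrite nt_naturalE z'0 linear0.
exists u; rewrite nt_compE mu linearD /= p2i1 p2i2 add0r; split=> //.
apply: (m_inj t); rewrite -nt_naturalE mu linearD /= !nt_naturalE y0 z'0.
by rewrite !linear0 addr0.
Qed.

Lemma rank_exact_category : exact_category (@rank_exact d P k).
Proof.
split.
- by apply: additive_biproduct; [exact: zero_rep_exists | exact: biproduct_exists].
- move=> X Y Z f g [fg _].
  by split; [exact: short_exact_kernel | exact: short_exact_cokernel].
- move=> X; apply/admissible_monicP; split=> [p x|s t h b a].
    by rewrite id_lfunE.
  by rewrite id_lfunE; exists b.
- move=> X; apply/admissible_epicP; split=> [p x|s t h y y0].
    by exists x; rewrite id_lfunE.
  by exists y; rewrite id_lfunE.
- by move=> X Y Z f g; apply: admissible_monic_comp.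
- by move=> X Y Z f g; apply: admissible_epic_comp.
- move=> X Y X' f h /(admissible_pushout_exists h)[Y' [f' [h' [po _]]]].
  by exists Y', f', h'.
- move=> X Y X' Y' f h f' h' fm [_ po].
  have [Y1 [f1 [h1 [[hf _] f1m]]]] := admissible_pushout_exists h fm.
  (* The given universal property yields [u] whose composite with [f'] is the constructed admissible
     monic [f1]. *)
  have [u [[_ uf] _]] := po Y1 h1 f1 hf.
  by apply: (@admissible_monic_factor _ _ _ f' u); rewrite [nt_comp _ _]uf.
- move=> Y Z Z' g h /(admissible_pullback_exists h)[Y' [g' [h' [pb _]]]].
  by exists Y', g', h'.
- move=> Y Z Z' Y' g h g' h' ge [_ pb].
  have [Y1 [g1 [h1 [[gh _] g1e]]]] := admissible_pullback_exists h ge.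
  have [u [[_ gu] _]] := pb Y1 h1 g1 gh.
  by apply: (@admissible_epic_factor _ _ _ u g'); rewrite [nt_comp _ _]gu.
Qed.

(** * Hook representations: lifting from lower hooks, extension to upper hooks *)

Definition ind_unit (b : bool) : ind_obj k b :=
  if b return ind_obj k b then (1 : k^o) else 0.

Definition ind_val (b : bool) : 'Hom(ind_obj k b, k^o) :=
  if b return 'Hom(ind_obj k b, k^o) then \1%VF else 0.

Definition ind_hom (V : vectType k) (b : bool) (v : V) : 'Hom(ind_obj k b, V) :=
  if b return 'Hom(ind_obj k b, V) then linfun (scale_line v) else 0.

Definition ind_cohom (V : vectType k) (b : bool) (e : 'Hom(V, k^o)) :
    'Hom(V, ind_obj k b) :=
  if b return 'Hom(V, ind_obj k b) then e else 0.

(** Testing maps out of [ind_obj k b] on this generator, and elements of it through [ind_val],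
    treats both values of [b] at once and avoids transports along equations [I p = true]. *)
Lemma ind_unit_ext (V : vectType k) b (f g : 'Hom(ind_obj k b, V)) :
  f (ind_unit b) = g (ind_unit b) -> f = g.
Proof.
case: b f g => f g fg; apply/lfunP => x.
  by rewrite -[x]mulr1 -[_ * _]/(_ *: (1 : k^o)) !linearZ /= fg.
by have -> : x = 0; [apply/rowP => -[] | rewrite !linear0].
Qed.

Lemma ind_val_inj b (x y : ind_obj k b) : ind_val b x = ind_val b y -> x = y.
Proof. by case: b x y => x y; [rewrite !id_lfunE | move=> _; apply/rowP => -[]]. Qed.

Lemma ind_hom_unit (V : vectType k) b (v : V) :
  ind_hom b v (ind_unit b) = if b then v else 0.
Proof. by case: b; rewrite /= lfunE //= /scale_line scale1r. Qed.

Lemma ind_val_cohom (V : vectType k) b (e : 'Hom(V, k^o)) x :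
  ind_val b (ind_cohom b e x) = if b then e x else 0.
Proof. by case: b; rewrite /= lfunE. Qed.

Lemma ind_map_unit b c : ind_map k b c (ind_unit b) = if b then ind_unit c else 0.
Proof. by case: b; case: c; rewrite /= lfunE. Qed.

Lemma ind_val_map b c x : ind_val c (ind_map k b c x) = if c then ind_val b x else 0.
Proof. by case: b x => x; case: c; rewrite /= ?lfunE /= ?lfunE. Qed.

Lemma ind_unit_false b : ~~ b -> ind_unit b = 0. Proof. by case: b. Qed.

Lemma ind_val_false b x : ~~ b -> ind_val b x = 0.
Proof. by case: b x => // x _; rewrite lfunE. Qed.

(** A Yoneda-type construction: an element of [B i] killed by [B(i,j)] is propagated along the
    structure maps. *)
Lemma lower_hook_hom B i j (b : B i) :
  before_pinfty i j ->
  (forall j' (h : (i <= j')%O), j = Some j' -> rep_map B h b = 0) ->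
  exists v : nat_trans (lower_hook_rep k i j) B,
    forall p (h : (i <= p)%O), lower_hook i j p ->
      v p (ind_unit (lower_hook i j p)) = rep_map B h b.
Proof.
move=> ij b0; pose I := lower_hook i j.
(* [rep_map] needs a proof of [i <= p], which [decP] provides; the value is [0] where there is
   none. *)
pose act p : B p := 
    if decP (@idP (i <= p)%O) is left h then rep_map B h b else 0.
have actE p (h : (i <= p)%O) : act p = rep_map B h b.
  by rewrite /act; case: decP => // h'; rewrite (bool_irrelevance h' h).
pose v p : 'Hom(ind_obj k (I p), B p) := ind_hom (I p) (act p).
have natural s t (st : (s <= t)%O) :
    (rep_map B st \o v s = v t \o ind_map k (I s) (I t))%VF.
  apply: ind_unit_ext; rewrite comp_lfunE [RHS]comp_lfunE ind_map_unit ind_hom_unit.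
  case: ifP => [/andP[le_is _]|_]; last by rewrite !linear0.
  rewrite ind_hom_unit (actE s le_is) (rep_map_compE _ _ (le_trans le_is st)).
  case: ifP => [_|]; first by rewrite (actE t (le_trans le_is st)).
  rewrite /I /lower_hook (le_trans le_is st) /=.
  (* Here [t] has left the hook, so [j' <= t] and [B(i,t)] factors through [B(i,j')], which kills
     [b]. *)
  case: j ij @I b0 v => // j' ij I b0 v /negbFE j't.
  have ij' : (i <= j')%O by exact: ltW.
  by rewrite -(rep_map_compE ij' j't) (b0 j') // linear0.
exists (@NatTrans d P k (lower_hook_rep k i j) B v natural) => p h Ip.
by rewrite ind_hom_unit Ip (actE p h).
Qed.

(** [w] is determined by its value [y] on the generator at [i], and [y] is killed by [D(i,j)]. It
    lifts to [B i] by [lifts_kernels], or by mere surjectivity when [j] is [None]. *)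
Lemma lower_hook_lift i j B D (f : nat_trans B D) :
  before_pinfty i j -> pointwise_surj f -> lifts_kernels f ->
  forall w : nat_trans (lower_hook_rep k i j) D,
    exists v : nat_trans (lower_hook_rep k i j) B, nt_comp f v = w.
Proof.
move=> ij f_surj f_lift w; pose I := lower_hook i j.
have Ii : I i.
  by rewrite /I /lower_hook lexx; case: j ij {w I} => //= j ij; rewrite lt_geF.
pose y : D i := w i (ind_unit (I i)).
have wE p (h : (i <= p)%O) : rep_map D h y = w p (ind_unit (I p)).
  rewrite nt_naturalE; congr (w p _).
  by apply: etrans (ind_map_unit _ _) _; rewrite [lower_hook i j i]Ii.
have [b [by_ b0]] : exists b : B i, f i b = y /\
    forall j' (h : (i <= j')%O), j = Some j' -> rep_map B h b = 0.
  case jE : j => [j'|]; last by have [b by_] := f_surj i y; exists b.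
  have ij' : (i <= j')%O by move: ij; rewrite jE; exact: ltW.
  have [|b [by_ b0]] := f_lift _ _ ij' y.
    by rewrite wE ind_unit_false ?linear0 // /I /lower_hook jE lexx andbF.
  exists b; split=> // j1 h [j1E]; subst j1.
  by rewrite (bool_irrelevance h ij').
have [v vE] := lower_hook_hom ij b0.
exists v; apply: nat_transP => p; apply: ind_unit_ext; rewrite comp_lfunE.
have [Ip|nIp] := boolP (I p); last by rewrite ind_unit_false // !linear0.
have /andP[ip _] := Ip.
by rewrite (vE p ip) // -wE -by_ nt_naturalE.
Qed.

Lemma upper_hook_hom B i j (e : 'Hom(B j, k^o)) :
  after_ninfty i j ->
  (forall i' (h : (i' <= j)%O), i = Some i' -> (e \o rep_map B h)%VF = 0) ->
  exists v : nat_trans B (upper_hook_rep k i j),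
    forall p (h : (p <= j)%O), upper_hook i j p ->
      (ind_val (upper_hook i j p) \o v p = e \o rep_map B h)%VF.
Proof.
move=> ij e0; pose I := upper_hook i j.
pose act p : 'Hom(B p, k^o) :=
  if decP (@idP (p <= j)%O) is left h then (e \o rep_map B h)%VF else 0.
have actE p (h : (p <= j)%O) : act p = (e \o rep_map B h)%VF.
  by rewrite /act; case: decP => // h'; rewrite (bool_irrelevance h' h).
pose v p : 'Hom(B p, ind_obj k (I p)) := ind_cohom (I p) (act p).
have natural s t (st : (s <= t)%O) :
    (ind_map k (I s) (I t) \o v s = v t \o rep_map B st)%VF.
  apply/lfunP=> x; apply: ind_val_inj.
  rewrite comp_lfunE [in RHS]comp_lfunE ind_val_map !ind_val_cohom.
  case: ifP => // /andP[_ tj].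
  rewrite (actE t tj) comp_lfunE (rep_map_compE _ _ (le_trans st tj)).
  case: ifP => [_|]; first by rewrite (actE s (le_trans st tj)) comp_lfunE.
  rewrite /I /upper_hook (le_trans st tj) andbT.
  (* Here [s] lies outside the hook, so [s <= i'] and [B(s,j)] factors through [B(i',j)], on whose
     image [e] vanishes. *)
  case: i ij @I e0 v => // i' ij I e0 v /negbFE si'.
  have i'j : (i' <= j)%O by exact: ltW.
  by rewrite -(rep_map_compE si' i'j) -comp_lfunE (e0 i') // zero_lfunE.
exists (@NatTrans d P k B (upper_hook_rep k i j) v natural) => p h Ip.
apply/lfunP=> x; rewrite comp_lfunE.
by apply: etrans (ind_val_cohom _ _ _) _; rewrite [upper_hook i j p]Ip (actE p h).
Qed.

(** [w] is determined by the functional [e] it induces on [A j], which vanishes on [im A(i,j)]. It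
    must extend to [B j] so as to vanish on [im B(i,j)]. *)
Lemma upper_hook_extend i j A B (f : nat_trans A B) :
  after_ninfty i j -> pointwise_inj f -> reflects_images f ->
  forall w : nat_trans A (upper_hook_rep k i j),
    exists v : nat_trans B (upper_hook_rep k i j), nt_comp v f = w.
Proof.
move=> ij f_inj f_refl w; pose I := upper_hook i j.
have Ij : I j.
  by rewrite /I /upper_hook lexx andbT; case: i ij {w I} => //= i ij; rewrite lt_geF.
pose e : 'Hom(A j, k^o) := (ind_val (I j) \o w j)%VF.
have wE p (h : (p <= j)%O) x : e (rep_map A h x) = ind_val (I p) (w p x).
  rewrite comp_lfunE.
  apply: etrans (congr1 (ind_val (I j)) (esym (nt_naturalE w h x))) _.
  by apply: etrans (ind_val_map _ _) _; rewrite Ij.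
have [e' [e'f e'0]] : exists e' : 'Hom(B j, k^o), (e' \o f j = e)%VF /\
    forall i' (h : (i' <= j)%O), i = Some i' -> (e' \o rep_map B h)%VF = 0.
  case iE : i => [i'|].
    have i'j : (i' <= j)%O by move: ij; rewrite iE; exact: ltW.
    have [a b fa|e' [e'f e'0]] := @functional_extend k _ _ _ _ (f j) (rep_map B i'j) e.
      (* Reflection of images gives the compatibility needed to extend: if [f j a] lies in
         [im B(i',j)], then [a] lies in [im A(i',j)], where [e] vanishes. *)
      have [a' <-] := f_refl _ _ i'j b a (esym fa).
      by rewrite wE ind_val_false // /I /upper_hook iE lexx.
    exists e'; split=> // i1 h [i1E]; subst i1.
    by rewrite (bool_irrelevance h i'j).
  (* For [i] equal to [None] there is no image to kill: with the zero map as [m], injectivity of [f]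
     is enough. *)
  have [a b|e' [e'f _]] := @functional_extend k _ _ _ _ (f j) (0 : 'Hom(B j, B j)) e.
    by rewrite zero_lfunE => /f_inj ->; rewrite linear0.
  by exists e'.
have [v vE] := upper_hook_hom ij e'0.
exists v; apply: nat_trans_ext => p x; apply: ind_val_inj; rewrite nt_compE.
have [Ip|nIp] := boolP (I p); last by rewrite !ind_val_false.
have /andP[_ pj] := Ip.
by rewrite -[LHS]comp_lfunE (vE p pj) // comp_lfunE nt_naturalE -comp_lfunE e'f wE.
Qed.

End Rep.

Theorem theorem4p6 (d : Order.disp_t) (P : porderType d) (k : fieldType) :
  [/\ exact_category (@rank_exact d P k),
      forall (n : nat) (i : 'I_n -> P) (j : 'I_n -> option P)
          (X : rep_cat P k),
        (forall a : 'I_n, before_pinfty (i a) (j a)) ->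
        @is_direct_sum (rep_cat P k) n
          (fun a => lower_hook_rep k (i a) (j a)) X ->
        projective_wrt (@rank_exact d P k) X
    & forall (n : nat) (i : 'I_n -> option P) (j : 'I_n -> P)
          (X : rep_cat P k),
        (forall a : 'I_n, after_ninfty (i a) (j a)) ->
        @is_direct_sum (rep_cat P k) n
          (fun a => upper_hook_rep k (i a) (j a)) X ->
        injective_wrt (@rank_exact d P k) X].
Proof.
have excat := @rank_exact_category d P k.
split=> // n i j X ij sumX.
- apply: projective_wrt_lift => [A B D f g fg|A B D f g fg].
    by have [] := exact_kc excat fg.
  have [/short_exactP[_ g_surj _] g_lift] := (rank_exact_lifts f g).1 fg.
  (* Lifting from the direct sum reduces to lifting from a single hook. *)
  by apply: (direct_sum_lift sumX) => a; apply: lower_hook_lift.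
- apply: injective_wrt_extend => [A B D f g fg|A B D f g fg].
    by have [] := exact_kc excat fg.
  have [/short_exactP[f_inj _ _] f_refl] := (rank_exact_reflects f g).1 fg.
  by apply: (direct_sum_extend sumX) => a; apply: upper_hook_extend.
Qed.
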